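(* Let $S$ be an infinite discrete semigroup with $|S|=\kappa$ that is very weakly cancellative, and assume there is a uniform, finite bound on $|\mathrm{Fix}(a)|$ for $a\in S$ (i.e. there is $k\in\mathbb{N}$ with $|\mathrm{Fix}(a)|\le k$ for all $a\in S$). Then for every minimal ultrafilter $p$ on $S$, the space $S^*\setminus\{p\}$ is not normal.
   Context: $\beta S$ is the set of ultrafilters on $S$ (principal ultrafilters identified with points of $S$), with the topology whose basic clopen sets are $\overline{A}=\{p\in\beta S: A\in p\}$, $A\subseteq S$; $S^*=\beta S\setminus S$ with the subspace topology. The operation of $S$ extends to $\beta S$ by: $A\in p\cdot q$ iff $\{x\in S: x^{-1}A\in q\}\in p$, where $x^{-1}A=\{y\in S: x\cdot y\in A\}$. This makes $\beta S$ a compact Hausdorff right topological semigroup; $K(\beta S)$ is its smallest two-sided ideal, and a minimal ultrafilter on $S$ is an element of $K(\beta S)$. (When $S$ is very weakly cancellative, $K(\beta S)\subseteq S^*$.) A left (resp. right) solution set in $S$ is a set of the form $\{x\in S: ax=b\}$ (resp. $\{x\in S: xa=b\}$) with $a,b\in S$. With $\kappa=|S|$, $S$ is very weakly cancellative if the union of fewer than $\kappa$ solution sets (left or right) always has cardinality less than $\kappa$. For $a\in S$, $\mathrm{Fix}(a)=\{x\in S: xa=a\}$. *)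

(* Defs.v *)
From HB Require Import structures.
From mathcomp Require Import all_boot all_classical.
From mathcomp Require Import topology.

Set Implicit Arguments.
Unset Strict Implicit.
Unset Printing Implicit Defensive.

Local Open Scope classical_set_scope.
Local Open Scope card_scope.
Local Open Scope group_scope.

(* The Stone-Cech compactification of a discrete space T, as the space of
   ultrafilters on T. *)
Record beta (T : Type) := Beta {
  ultra_of : set_system T;
  ultra_ofP : UltraFilter ultra_of
}.

#[global] Existing Instance ultra_ofP.

HB.instance Definition _ (T : Type) := gen_eqMixin (beta T).
HB.instance Definition _ (T : Type) := gen_choiceMixin (beta T).

Lemma beta_ext (T : Type) (p q : beta T) : ultra_of p = ultra_of q -> p = q.
Proof.
case: p q => [P Pu] [Q Qu] /= PQ; rewrite PQ in Pu *.
by congr Beta; exact: Prop_irrelevance.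
Qed.

(* The basic clopen set of all ultrafilters containing A. *)
Definition beta_basic (T : Type) (A : set T) : set (beta T) := [set p : beta T | ultra_of p A].

Lemma beta_basic_cover (T : Type) :
  \bigcup_(A in [set: set T]) beta_basic A = [set: beta T].
Proof. by rewrite predeqE => p; split=> // _; exists setT => //; exact: filterT. Qed.

Lemma beta_basic_join (T : Type) (A B : set T) (p : beta T) :
  setT A -> setT B -> beta_basic A p -> beta_basic B p ->
  exists C, [/\ setT C, beta_basic C p &
                beta_basic C `<=` beta_basic A `&` beta_basic B].
Proof.
move=> _ _ pA pB; exists (A `&` B); split=> //; first exact: filterI.
by move=> q qAB; split; apply: filterS qAB => x [].
Qed.

HB.instance Definition _ (T : Type) :=
  isBaseTopological.Build (beta T) (@beta_basic_cover T) (@beta_basic_join T).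

Definition principal (T : Type) (x : T) : beta T :=
  Beta (principal_filter_ultra x).

(* S^* = beta S \ S, points of S being identified with principal ultrafilters. *)
Definition remainder (T : Type) : set (beta T) := ~` range (@principal T).
Arguments remainder : clear implicits.

Lemma ultra_of_dichotomy (T : Type) (F : set_system T) :
  ProperFilter F -> (forall A, F A \/ F (~` A)) -> UltraFilter F.
Proof.
move=> FF FC; split=> // G GF FG; rewrite eqEsubset; split=> // A GA.
case: (FC A) => // /FG GnA.
by have /filter_ex [x []] : G (A `&` ~` A) by exact: filterI.
Qed.

Definition beta_mul_sets (S : magmaType) (p q : beta S) : set_system S :=
  [set A | ultra_of p [set x | ultra_of q [set y | A (x * y)]]].

Lemma beta_mul_ultra (S : magmaType) (p q : beta S) :
  UltraFilter (beta_mul_sets p q).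
Proof.
apply: ultra_of_dichotomy => [|A]; first split.
- rewrite /beta_mul_sets /= => p0; apply: (filter_not_empty (ultra_of p)).
  by apply: filterS p0 => x /= q0; apply: (filter_not_empty (ultra_of q)); exact: q0.
- split=> [|A B pA pB|A B AB].
  + by apply: (@filterE _ (ultra_of p)) => x; exact: filterT.
  + by apply: (@filterS2 _ (ultra_of p)) pA pB => x; exact: filterI.
  + by apply: (@filterS _ (ultra_of p)) => x /=; apply: filterS => y; exact: AB.
- have [pA|pA] := in_ultra_setVsetC [set x | ultra_of q [set y | A (x * y)]] (ultra_ofP p).
    by left.
  right; apply: (@filterS _ (ultra_of p)) pA => x /= nqA.
  by have [] := in_ultra_setVsetC [set y | A (x * y)] (ultra_ofP q).
Qed.

Definition beta_mul (S : magmaType) (p q : beta S) : beta S :=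
  Beta (beta_mul_ultra p q).

Lemma beta_mulA (S : semigroupType) : associative (@beta_mul S).
Proof.
move=> p q r; apply: beta_ext; apply/funext => A /=; rewrite /beta_mul_sets /=.
congr (ultra_of p _); apply/funext => x /=; congr (ultra_of q _).
apply/funext => y /=; congr (ultra_of r _); apply/funext => z /=.
by rewrite mulgA.
Qed.

HB.instance Definition _ (S : semigroupType) :=
  isSemigroup.Build (beta S) (@beta_mulA S).

Lemma principalM (S : semigroupType) (x y : S) :
  principal (x * y) = principal x * principal y.
Proof.
apply: beta_ext; apply/funext => A; rewrite /= /beta_mul_sets.
by apply/propext; rewrite /= !principal_filterP /= !principal_filterP.
Qed.

Definition two_sided_ideal (G : magmaType) (I : set G) : Prop :=
  I !=set0 /\ forall x y, I y -> I (x * y) /\ I (y * x).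

(* [smallest C set0] is the intersection of all sets satisfying [C]; this is
   K(G) when G has a smallest two-sided ideal, as [beta S] does for S
   nonempty. *)
Definition smallest_ideal (G : magmaType) : set G :=
  smallest (@two_sided_ideal G) set0.
Arguments smallest_ideal : clear implicits.

Definition minimal_ultrafilter (S : semigroupType) (p : beta S) : Prop :=
  smallest_ideal (beta S) p.

Definition left_solution_set (S : magmaType) (a b : S) : set S :=
  [set x | a * x = b].

Definition right_solution_set (S : magmaType) (a b : S) : set S :=
  [set x | x * a = b].

Definition solution_set (S : magmaType) (X : set S) : Prop :=
  exists a b, X = left_solution_set a b \/ X = right_solution_set a b.

Definition card_lt (T U : Type) (A : set T) (B : set U) : Prop :=
  A #<= B /\ ~ (B #<= A).

Definition very_weakly_cancellative (S : magmaType) : Prop :=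
  forall F : set (set S), F `<=` @solution_set S -> card_lt F [set: S] ->
    card_lt (\bigcup_(X in F) X) [set: S].

Definition Fix (S : magmaType) (a : S) : set S := [set x | x * a = a].

(* Main.v *)
From HB Require Import structures.
Require Import Defs.
From mathcomp Require Import all_boot finmap all_classical.
From mathcomp Require Import topology wochoice.
From Stdlib Require Import Wellfounded.

(** Let L be the minimal left ideal of beta S that contains p.  It is closed,
    and it contains an idempotent f with f p = p and l f = l for all l in L
    ([minimal_ultrafilter_idempotent]).  In X = S^* \ {p} the sets

      F = { z in X | z in L }   and   G = { z in X | z f = p }

    are closed, and they are disjoint because z = z f for z in L.  They cannot
    be separated: for every neighbourhood U of F in X, the closure of U meets G.

    To see this, call x good when x f <> p.  Then x f is in F, so some D_x in
    x f has all its ultrafilters from X in U; put A_x = { y | x y in D_x }, a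
    member of f.  As finitely many sets A_x always meet, there are ultrafilters
    r containing all of them, and then x r is in U for every good x, as soon as
    x r is in X.  Since r f is in L, some q satisfies q r f = p.  If the good
    points form a member of q, then q r is a limit of points x r in U, hence in
    the closure of U, and q r is in G, as soon as q r is in X.  Two things are
    left.

    - The points x r and q r have to be nonprincipal and different from p.
      All members of f have the cardinality of S
      ([minimal_ultrafilter_uniform]), whereas fewer than |S| solution sets
      never cover such a set.  A transfinite recursion of length |S| therefore
      chooses r_(H,b), for finite lists H and b a boolean, in A_x for all x in
      H, such that x r_i <> x' r_j whenever i <> j, x is in H_i and x' in H_j
      ([ex_sparse_family]).  The sets { x r_(H,b) | x in H } for the two values
      of b are disjoint, so one of them, B, is not in p.  An ultrafilter r to
      which r_(H,b) tends as H grows has B in all x r, thus also in q r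
      ([ex_sparse_ultrafilter]).

    - The good points have to form a member of q.  If they do not, q is
      replaced by f q.  If that fails as well, f-many s satisfy s p = p.  By
      the theorem of Katetov on fixed points of ultrafilters
      ([ultra_fixpoints]), k + 1 such s would have a common fixed point
      y = s y, against |Fix(y)| <= k ([ex_left_factor]).

    The recursion counts pairs and finite lists, which rests on the fact that
    an infinite set has as many finite lists as elements ([card_seq]). *)

Set Implicit Arguments.
Unset Strict Implicit.
Unset Printing Implicit Defensive.

Local Open Scope classical_set_scope.
Local Open Scope card_scope.

(** * Cardinal arithmetic *)

(** An inhabitant of the codomain lets an injection between subsets be a total
    function, which avoids subtypes in all counting arguments. *)
Lemma card_le_injP (T U : Type) (u : U) (A : set T) (B : set U) :
  A #<= B <-> exists f : T -> U, set_fun A B f /\ set_inj A f.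
Proof.
split.
  elim/Pchoice: U => U in u B *.
  pose U' : pointedType := HB.pack U (isPointed.Build U u).
  move=> /(@pcard_leP T U' A B) [f]; exists f; split; last exact: inj.
  by move=> x Ax; exact: funS.
move=> [f [fAB finj]].
have /injfunPex[g] : exists2 f : T -> U, set_fun A B f & set_inj A f by exists f.
exact: inj_card_le.
Qed.

(** A maximal graph of a partial injection from [A] to [B] exhausts one of the
    two sides. *)
Lemma card_le_total (T U : Type) (A : set T) (B : set U) :
  A #<= B \/ B #<= A.
Proof.
pose P := [set G : set (T * U) | [/\ G `<=` A `*` B,
   forall x y y', G (x, y) -> G (x, y') -> y = y' &
   forall x x' y, G (x, y) -> G (x', y) -> x = x']].
have [F FP totF|G [[GAB Gf Gi] Gmax]] := @Zorn_bigcup (T * U)%type P.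
  have two z z' : (\bigcup_(X in F) X) z -> (\bigcup_(X in F) X) z' ->
      exists2 X, F X & X z /\ X z'.
    move=> [X FX Xz] [Y FY Yz']; have [XY|YX] := totF _ _ FX FY.
      by exists Y => //; split => //; exact: XY.
    by exists X => //; split => //; exact: YX.
  split.
  - by move=> z [X FX Xz]; have [+ _ _] := FP _ FX; apply.
  - move=> x y y' /two/[apply] -[X FX [Xy Xy']].
    by have [_ + _] := FP _ FX; apply; [exact: Xy|exact: Xy'].
  - move=> x x' y /two/[apply] -[X FX [Xy Xy']].
    by have [_ _ +] := FP _ FX; apply; [exact: Xy|exact: Xy'].
have [dA|/existsNP[a /not_implyP[Aa aG]]] :=
    pselect (forall a, A a -> exists b, G (a, b)).
  have [->|/set0P[a0 Aa0]] := eqVneq A set0; first by left; exact: card_ge0.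
  have [b0 _] := dA _ Aa0; left.
  have /choice[f fP] : forall a, exists b, A a -> G (a, b).
    move=> a; have [Aa|nAa] := pselect (A a).
      by have [b ?] := dA _ Aa; exists b.
    by exists b0.
  apply/(card_le_injP b0); exists f; split.
    by move=> a Aa; have [] := GAB _ (fP _ Aa).
  move=> a a' /set_mem Aa /set_mem Aa' faa'.
  by apply: Gi (fP _ Aa) _; rewrite faa'; exact: fP.
right.
have dB b : B b -> exists a, G (a, b).
  move=> Bb; apply: contrapT => bG.
  apply: (Gmax (G `|` [set (a, b)])).
    split; first by move=> z; left.
    by move=> /(_ (a, b)) Gab; apply: bG; exists a; apply: Gab; right.
  split.
  - by move=> z [/GAB//|->].
  - move=> x y y' [Gy|[xa yb]] [Gy'|[xa' yb']]; first exact: Gf Gy Gy'.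
    + by case: aG; exists y; rewrite -xa'.
    + by case: aG; exists y'; rewrite -xa.
    + by rewrite yb yb'.
  - move=> x x' y [Gy|[xa yb]] [Gy'|[xa' yb']]; first exact: Gi Gy Gy'.
    + by case: bG; exists x; rewrite -yb'.
    + by case: bG; exists x'; rewrite -yb.
    + by rewrite xa xa'.
have /choice[f fP] : forall b, exists a, B b -> G (a, b).
  move=> b; have [Bb|nBb] := pselect (B b).
    by have [a' ?] := dB _ Bb; exists a'.
  by exists a.
apply/(card_le_injP a); exists f; split.
  by move=> b Bb; have [] := GAB _ (fP _ Bb).
move=> b b' /set_mem Bb /set_mem Bb' fbb'.
by apply: Gf (fP _ Bb) _; rewrite fbb'; exact: fP.
Qed.

(** Membership is spelled out along the list, so that it computes on explicit
    lists over a type without decidable equality. *)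
Definition word (T : Type) (A : set T) : set (seq T) :=
  [set s | foldr (fun x P => A x /\ P) True s].

Lemma word_subset (T : Type) (A B : set T) (s : seq T) :
  A `<=` B -> word A s -> word B s.
Proof. by move=> AB; elim: s => //= x s IH [/AB ? /IH]. Qed.

Lemma word_map (T U : Type) (f : T -> U) (A : set T) (B : set U) (s : seq T) :
  set_fun A B f -> word A s -> word B (map f s).
Proof. by move=> fAB; elim: s => //= x s IH [/fAB ? /IH]. Qed.

Lemma word_inj_map (T U : Type) (f : T -> U) (A : set T) (s t : seq T) :
  set_inj A f -> word A s -> word A t -> map f s = map f t -> s = t.
Proof.
move=> finj; elim: s t => [|x s IH] [|y t] //= [Ax As] [Ay At] [fxy fst].
by rewrite (IH t) //; congr cons; apply: finj => //; exact: mem_set.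
Qed.

(** Zorn's lemma gives a maximal injection [G] of the nonempty words over a set
    [D] into [D], as a graph.  One-letter and two-letter words embed the sum of
    two copies of [D] into [D].  If the complement of [D] embeds into [D],
    then so does the whole type, and words over the type embed into words over
    [D], hence into [D].  Otherwise the complement contains a copy [E] of [D],
    and the words over the union of [D] and [E] that are not words over [D] can
    be sent into [E], against maximality. *)
Lemma card_seq (T : Type) : infinite_set [set: T] -> [set: seq T] #<= [set: T].
Proof.
move=> /infiniteP Tinf.
have [t0 _] : [set: T] !=set0.
  by apply: infinite_setN0; exact/infiniteP.
pose D (G : set (seq T * T)) : set T := [set x | exists y, G ([:: x], y)].
pose P := [set G | [/\ forall s y, G (s, y) -> word (D G) s /\ D G y,
   forall x s, word (D G) (x :: s) -> exists y, G (x :: s, y),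
   forall s y y', G (s, y) -> G (s, y') -> y = y' &
   forall s s' y, G (s, y) -> G (s', y) -> s = s']].
(* The empty word is left out so that the empty graph is admissible: it is the
   union of the empty chain. *)
have [F FP totF|G [[Ga Gb Gf Gi] Gmax]] := @Zorn_bigcup (seq T * T)%type P.
  have two z z' : (\bigcup_(X in F) X) z -> (\bigcup_(X in F) X) z' ->
      exists2 X, F X & X z /\ X z'.
    move=> [X FX Xz] [Y FY Yz']; have [XY|YX] := totF _ _ FX FY.
      by exists Y => //; split => //; exact: XY.
    by exists X => //; split => //; exact: YX.
  have subD X : F X -> D X `<=` D (\bigcup_(X in F) X).
    by move=> FX x [y Xy]; exists y, X.
  split.
  - move=> s y [X FX Xsy]; have [+ _ _ _] := FP _ FX => /(_ _ _ Xsy)[ws Dy].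
    by split; [exact: word_subset (subD _ FX) ws|exact: subD Dy].
  - move=> x s xs.
    suff [X FX] : exists2 X, F X & word (D X) (x :: s).
      by have [_ + _ _] := FP _ FX => /[apply] -[y Xy]; exists y, X.
    elim: s x xs => [|x' s IH] x [[y [X FX Xy]] xs].
      by exists X => //=; split => //; exists y.
    have [Y FY /= wY] := IH _ xs; have [XY|YX] := totF _ _ FX FY.
      by exists Y => //; split => //; exists y; exact: XY.
    exists X => //; split => //; first by exists y.
    by apply: word_subset (wY : word _ (_ :: _)) => z [u Yu]; exists u; exact: YX.
  - move=> x y y' /two/[apply] -[X FX [Xy Xy']].
    by have [_ _ + _] := FP _ FX; apply; [exact: Xy|exact: Xy'].
  - move=> x x' y /two/[apply] -[X FX [Xy Xy']].
    by have [_ _ _ +] := FP _ FX; apply; [exact: Xy|exact: Xy'].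
have ext (E : set T) (h : seq T -> T) : E !=set0 -> E `<=` ~` D G ->
    set_fun (word (D G `|` E)) E h -> ~ set_inj (word (D G `|` E)) h.
  move=> [e Ee] ED hE hinj.
  pose N := [set z : seq T * T | [/\ z.1 != nil :> {classic seq T}, word (D G `|` E) z.1,
    ~ word (D G) z.1 & z.2 = h z.1]].
  have N1 x : E x -> (G `|` N) ([:: x], h [:: x]).
    move=> Ex; right; split => //=; first exact/eqP.
      by split => //; right.
    by move=> [/(ED _ Ex)].
  have DGN : D (G `|` N) = D G `|` E.
    apply/seteqP; split => [x [y [Gy|[_ /= [? _]]]]//|x [[y Gy]|Ex]].
    - by left; exists y.
    - by exists y; left.
    - by exists (h [:: x]); exact: N1.
  apply: (Gmax (G `|` N)).
    split; first by move=> z; left.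
    move=> /(_ _ (N1 _ Ee)) eG; apply: ED Ee _.
    by exists (h [:: e]).
  split.
  - rewrite DGN => s y [/Ga[ws Dy]|[_ /= ws _ ->]].
      by split; [apply: word_subset ws => z; left|left].
    by split => //; right; exact: hE.
  - rewrite DGN => x s ws.
    have [/Gb[y Gy]|nw] := pselect (word (D G) (x :: s)); first by exists y; left.
    by exists (h (x :: s)); right; split => //; exact/eqP.
  - move=> s y y' [Gy|[_ ws nws ys]] [Gy'|[_ ws' nws' ys']].
    + exact: Gf Gy Gy'.
    + by have [] := Ga _ _ Gy.
    + by have [] := Ga _ _ Gy'.
    + by move: ys ys' => /= -> ->.
  - move=> s s' y [Gy|[_ ws nws ys]] [Gy'|[_ ws' nws' ys']].
    + exact: Gi Gy Gy'.
    + have [_ Dy] := Ga _ _ Gy; case: (ED y) => //.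
      by rewrite [y]ys' /=; exact: hE.
    + have [_ Dy] := Ga _ _ Gy'; case: (ED y) => //.
      by rewrite [y]ys /=; exact: hE.
    + by apply: hinj; [exact: mem_set|exact: mem_set|rewrite -[LHS]ys -[RHS]ys'].
have /(card_le_injP t0)[n [_ ninj]] := Tinf.
have {}ninj : injective n by move=> i j; apply: ninj; rewrite inE.
(* If [D] is empty, an infinite sequence with its countably many words extends [G]. *)
have [G0|/set0P[x0 Dx0]] := eqVneq (D G) set0.
  have /choice[m mP] : forall x, exists i, range n x -> n i = x.
    move=> x; have [[i _ <-]|nx] := pselect (range n x); first by exists i.
    by exists 0.
  exfalso; apply: (ext (range n) (fun s => n (choice.pickle (map m s)))).
  - by exists (n 0), 0.
  - by rewrite G0 setC0.
  - by move=> s _; exists (choice.pickle (map m s)).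
  - move=> s t; rewrite G0 set0U => /set_mem ws /set_mem wt.
    move=> /ninj/(pcan_inj choice.pickleK) mst.
    apply: (word_inj_map _ ws wt mst) => x y /set_mem/mP {2}<- /set_mem/mP {2}<-.
    by move=> ->.
have /choice[f fP] : forall s, exists y, s <> nil -> word (D G) s -> G (s, y).
  move=> [|x s]; first by exists t0.
  have [/Gb[y Gy]|nw] := pselect (word (D G) (x :: s)); first by exists y.
  by exists t0.
have fD x s : word (D G) (x :: s) -> D G (f (x :: s)).
  by move=> ws; have [] := Ga _ _ (fP (x :: s) (fun e => ltac:(by [])) ws).
have finj x s y t : word (D G) (x :: s) -> word (D G) (y :: t) ->
    f (x :: s) = f (y :: t) -> x :: s = y :: t.
  by move=> ws wt fst; apply: Gi (fP _ _ ws) _ => //; rewrite fst; exact: fP.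
have w1 x : D G x -> word (D G) [:: x] by [].
have w2 x : D G x -> word (D G) [:: x; x] by [].
have absorb E : E `<=` ~` D G -> E #<= D G ->
    exists h, set_fun (word (D G `|` E)) (D G) h /\ set_inj (word (D G `|` E)) h.
  move=> ED /(card_le_injP t0)[k [kD kinj]].
  pose j x := if `[< D G x >] then f [:: x] else f [:: k x; k x].
  have jD : set_fun (D G `|` E) (D G) j.
    move=> x; rewrite /j; case: asboolP => [Dx _|nDx [//|Ex]]; apply: fD => //=.
    by split; [|split] => //; exact: kD.
  have jinj : set_inj (D G `|` E) j.
    move=> x y /set_mem xW /set_mem yW; rewrite /j.
    case: asboolP => [Dx|nDx]; case: asboolP => [Dy|nDy].
    - by move=> /(finj _ _ _ _ (w1 _ Dx) (w1 _ Dy))[].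
    - case: yW => // Ey; have Dk := kD _ Ey.
      by move=> /(finj _ _ _ _ (w1 _ Dx) (w2 _ Dk)).
    - case: xW => // Ex; have Dk := kD _ Ex.
      by move=> /(finj _ _ _ _ (w2 _ Dk) (w1 _ Dy)).
    - case: xW => // Ex; case: yW => // Ey; have Dk := kD _ Ex; have Dk' := kD _ Ey.
      move=> /(finj _ _ _ _ (w2 _ Dk) (w2 _ Dk'))[+ _].
      by apply: kinj; exact: mem_set.
  exists (fun s => f (x0 :: map j s)); split.
    by move=> s ws; apply: fD => //=; split => //; exact: word_map ws.
  move=> s t /set_mem ws /set_mem wt.
  have wx0 r : word (D G `|` E) r -> word (D G) (x0 :: map j r).
    by move=> wr; split => //; exact: word_map wr.
  move=> /(finj _ _ _ _ (wx0 _ ws) (wx0 _ wt)).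
  by move=> [] /(word_inj_map jinj ws wt).
have [DE|ED] := card_le_total (~` D G) (D G).
  have [h [_ hinj]] := absorb _ (@subset_refl _ _) DE; apply/(card_le_injP t0).
  exists h; split => // s t _ _; rewrite setUv in hinj.
  have wT : forall s, word [set: T] s by elim => /=.
  by apply: hinj; exact: mem_set.
have /(card_le_injP t0)[k [kE kinj]] := ED.
have kD : k @` D G `<=` ~` D G by move=> _ [x Dx <-]; exact: kE.
have [h [hD hinj]] := absorb _ kD (card_image_le _ _).
exfalso; apply: (ext (k @` D G) (k \o h)) => //.
- by exists (k x0), x0.
- by move=> s ws; exists (h s) => //; exact: hD.
- move=> s t ws wt /= kh; apply: hinj => //.
  by apply: kinj => //; apply: mem_set; apply: hD; exact: set_mem.
Qed.

Lemma card_word (T : Type) (A : set T) : infinite_set A -> word A #<= A.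
Proof.
move=> Ainf; have [a0 Aa0] := infinite_setN0 Ainf.
have /choice[c cP] : forall x, exists y : A, A x -> \val y = x.
  move=> x; have [Ax|nAx] := pselect (A x); last by exists (SigSub (mem_set Aa0)).
  by exists (SigSub (mem_set Ax)).
have Tinf : infinite_set [set: A] by rewrite (eq_finite_set (card_setT A)).
have /card_eqPle[TA _] := card_setT A; apply: (card_le_trans _ TA).
apply: (card_le_trans _ (card_seq Tinf)).
apply/(card_le_injP nil); exists (map c); split=> // s t /set_mem ws /set_mem wt.
apply: (word_inj_map _ ws wt) => x y /set_mem Ax /set_mem Ay cxy.
by rewrite -(cP _ Ax) -(cP _ Ay) cxy.
Qed.

Lemma card_le_setX (T U : Type) (A : set T) (B : set U) :
  infinite_set B -> A #<= B -> A `*` B #<= B.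
Proof.
move=> Binf; have [b0 _] := infinite_setN0 Binf.
move=> /(card_le_injP b0)[f [fAB finj]].
apply: (card_le_trans _ (card_word Binf)).
apply/(card_le_injP nil); exists (fun z => [:: f z.1; z.2]); split.
  by move=> z [/= /fAB].
move=> [x y] [x' y'] /set_mem[/= Ax _] /set_mem[/= Ax' _] [fx ->].
by congr pair; apply: finj => //; exact: mem_set.
Qed.

(** Sets into which a fixed infinite set [C] does not embed, that is, sets of
    cardinality less than that of [C]; they are called small below. *)
Section not_card_ge.
Variables (T : Type) (C : set T).
Hypothesis Cinf : infinite_set C.

Lemma finite_not_card_ge (U : Type) (A : set U) : finite_set A -> ~ (C #<= A).
Proof. by move=> Afin /card_le_finite/(_ Afin). Qed.

Lemma not_card_geX (U V : Type) (A : set U) (B : set V) :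
  ~ (C #<= A) -> ~ (C #<= B) -> ~ (C #<= A `*` B).
Proof.
move=> nCA nCB.
have [fA|infA] := pselect (finite_set A); have [fB|infB] := pselect (finite_set B).
- exact: finite_not_card_ge (finite_setX fA fB).
- have [AB|BA] := card_le_total A B.
    by move=> /card_le_trans/(_ (card_le_setX infB AB)).
  by case: infB; exact: card_le_finite fA.
- have [AB|BA] := card_le_total A B.
    by case: infA; exact: card_le_finite fB.
  move=> CAB; apply: nCA; apply: (card_le_trans _ (card_le_setX infA BA)).
  apply: (card_le_trans CAB).
  apply: (card_le_trans _ (card_image_le (fun z => (z.2, z.1)) _)).
  by apply: subset_card_le => -[x y] [/= Ax By]; exists (y, x).
- have [AB|BA] := card_le_total A B.
    by move=> /card_le_trans/(_ (card_le_setX infB AB)).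
  move=> CAB; apply: nCA; apply: (card_le_trans _ (card_le_setX infA BA)).
  apply: (card_le_trans CAB).
  apply: (card_le_trans _ (card_image_le (fun z => (z.2, z.1)) _)).
  by apply: subset_card_le => -[x y] [/= Ax By]; exists (y, x).
Qed.

(** For infinite [A] the union is an image of the product of [A] and nat, where
    nat embeds into [A] and is therefore small.  For finite [A] the union is
    finite; nat need not be small in this case. *)
Lemma not_card_ge_bigcup (J : Type) (U : eqType) (A : set J) (F : J -> seq U) :
  ~ (C #<= A) -> ~ (C #<= \bigcup_(j in A) [set` F j]).
Proof.
move=> nCA; have [Afin|Ainf] := pselect (finite_set A).
  by apply: finite_not_card_ge; apply: bigcup_finite => // i _; exact: finite_seq.
have [->|/set0P[u0 _]] := eqVneq (\bigcup_(j in A) [set` F j]) set0.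
  exact: finite_not_card_ge.
move=> Cle; apply: (@not_card_geX _ _ A [set: nat] nCA).
  by move=> Cnat; apply: nCA; apply: (card_le_trans Cnat); exact/infiniteP.
apply: (card_le_trans Cle).
apply: (card_le_trans _ (card_image_le (fun z => nth u0 (F z.1) z.2) _)).
apply: subset_card_le => u [j Aj /= uF]; exists (j, index u (F j)) => //=.
exact: nth_index.
Qed.

(** If [A] embeds into [B], each point of [B] is grouped with the point of [A]
    above it, if any, and the union becomes a union of pairs indexed by [B]. *)
Lemma not_card_geU (U : choiceType) (A B : set U) :
  ~ (C #<= A) -> ~ (C #<= B) -> ~ (C #<= A `|` B).
Proof.
wlog AB : A B / A #<= B.
  move=> H nA nB; have [AB|BA] := card_le_total A B; first exact: H.
  by rewrite setUC; exact: H.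
move=> _ nCB; have [->|/set0P[a _]] := eqVneq A set0; first by rewrite set0U.
have /(card_le_injP a)[f [fAB finj]] := AB.
have /choice[g gP] : forall y, exists x, forall x', A x' -> f x' = y -> x' = x.
  move=> y; have [[x Ax fx]|nx] := pselect (exists2 x, A x & f x = y).
    by exists x => x' Ax' fx'; apply: finj; [exact: mem_set|exact: mem_set|rewrite fx'].
  by exists a => x' Ax' fx'; case: nx; exists x'.
move=> Cle; apply: (@not_card_ge_bigcup U U B (fun y => [:: y; g y]) nCB).
apply: (card_le_trans Cle); apply: subset_card_le => x [Ax|Bx].
  exists (f x); first exact: fAB.
  by rewrite /= -(gP (f x) x Ax erefl) !inE eqxx orbT.
by exists x => //=; rewrite mem_head.
Qed.

End not_card_ge.

(** The strict order of an initial ordinal.  In a well-order with a proper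
    initial segment equinumerous to [T], the order of the least such segment is
    pulled back to [T]. *)
Lemma ex_initial_order (T : Type) : exists R : T -> T -> Prop,
  [/\ well_founded R, forall x y, x <> y -> R x y \/ R y x &
      forall x, ~ ([set: T] #<= [set y | R y x])].
Proof.
elim/Pchoice: T => T.
have [W Wwo] := well_ordering_principle T.
pose R x y := W x y /\ x <> y.
have Wmin (A : set T) : A !=set0 -> exists2 x, A x & forall y, A y -> W x y.
  move=> [x Ax]; have [|z [[zA zmin] _]] := Wwo (fun x => x \in A).
    by exists x; rewrite unfold_in; exact: mem_set.
  exists z; first by apply: set_mem; move: zA; rewrite unfold_in.
  by move=> y Ay; apply: zmin; rewrite unfold_in; exact: mem_set.
have Wxx x : W x x by have [|_ -> /(_ _ erefl)] := Wmin [set x]; first by exists x.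
have Wtot x y : W x y \/ W y x.
  have [|_ [->|->] H] := Wmin [set x; y]; first by exists x; left.
    by left; apply: H; right.
  by right; apply: H; left.
have Wanti x y : W x y -> W y x -> x = y.
  move=> Wxy Wyx; have [|z [[zA zmin] uz]] := Wwo [pred z | (z == x) || (z == y)].
    by exists x; rewrite inE eqxx.
  have <- : z = x.
    apply: uz; split; first by rewrite inE eqxx.
    by move=> u; rewrite inE => /orP[] /eqP ->.
  apply: uz; split; first by rewrite inE eqxx orbT.
  by move=> u; rewrite inE => /orP[] /eqP ->.
have Rwf : well_founded R.
  move=> x; apply: contrapT => nx.
  have [|z nz zmin] := Wmin [set x | ~ Acc R x]; first by exists x.
  apply: nz; constructor => y [Wyz yz]; apply: contrapT => ny.
  by apply: yz; apply: Wanti => //; exact: zmin.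
have Rtot x y : x <> y -> R x y \/ R y x.
  by move=> xy; have [W1|W1] := Wtot x y; [left|right]; split => // /esym.
have [Rini|/existsNP[x0 /contrapT x0T]] :=
    pselect (forall x, ~ ([set: T] #<= [set y | R y x])); first by exists R.
have [|x xT xmin] := Wmin [set x | [set: T] #<= [set y | R y x]]; first by exists x0.
have /(card_le_injP x)[h [hR hinj]] := xT.
exists (fun y z => R (h y) (h z)); split.
- exact: wf_inverse_image Rwf.
- move=> y z yz; apply: Rtot => /hinj hyz; apply: yz; apply: hyz; exact: mem_set.
- move=> y yT; have [Whx nhx] : R (h y) x by exact: hR.
  apply: nhx; apply: Wanti => //; apply: xmin => /=.
  apply: (card_le_trans yT); apply/(card_le_injP x); exists h; split => // a b _ _.
  by apply: hinj; exact: mem_set.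
Qed.

(** Transfinite recursion in which each value is only required to satisfy a
    condition relative to the earlier ones.  The default [t0] extends a
    partial sequence of earlier values to a total function. *)
Lemma wf_choice (I T : Type) (t0 : T) (R : I -> I -> Prop) (C : I -> T -> Prop)
    (Q : I -> I -> T -> T -> Prop) : well_founded R ->
  (forall i (g : I -> T), exists y, C i y /\ forall j, R j i -> Q i j y (g j)) ->
  exists r : I -> T, forall i, C i (r i) /\ forall j, R j i -> Q i j (r i) (r j).
Proof.
move=> Rwf H.
have /choice[c cP] : forall z : I * (I -> T), exists y,
    C z.1 y /\ forall j, R j z.1 -> Q z.1 j y (z.2 j) by move=> [i g]; exact: H.
pose total i (rec : forall j, R j i -> T) j :=
  if pselect (R j i) is left h then rec j h else t0.
pose step i rec := c (i, @total i rec).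
have stepE i (rec rec' : forall j, R j i -> T) :
    (forall j h, rec j h = rec' j h) -> step i rec = step i rec'.
  move=> e; congr (c (_, _)); apply/funext => j; rewrite /total.
  by case: pselect.
exists (Wf.Fix Rwf (fun=> T) step) => i; rewrite (Fix_eq Rwf _ _ stepE).
rewrite {1 2}/step; set g := total i _.
have [Cy Qy] := cP (i, g); split => // j Rji.
by have := Qy _ Rji; rewrite /g /= /total; case: pselect.
Qed.

(** * The space of ultrafilters *)

Lemma ultra_setC (T : Type) (p : beta T) (A : set T) :
  ~ ultra_of p A -> ultra_of p (~` A).
Proof. by move=> nA; have [] := in_ultra_setVsetC A (ultra_ofP p). Qed.

Lemma ultra_nonempty (T : Type) (p : beta T) (A : set T) :
  ultra_of p A -> A !=set0.
Proof. exact: (@filter_ex _ (ultra_of p)). Qed.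

Lemma ultra_eqP (T : Type) (p q : beta T) :
  (forall A, ultra_of p A -> ultra_of q A) -> p = q.
Proof.
move=> pq; apply: beta_ext; apply/esym; apply: (@max_filter _ _ (ultra_ofP p)) => //.
Qed.

Lemma beta_nbhsP (T : Type) (p : beta T) (U : set (beta T)) :
  nbhs p U <-> exists2 A, ultra_of p A & beta_basic A `<=` U.
Proof.
split=> [|[A pA AU]].
  rewrite nbhsE => -[V [[/= D _ DV]] Vp VU].
  move: Vp; rewrite -DV => -[A DA pA]; exists A => //.
  by move=> q Aq; apply: VU; rewrite -DV; exists A.
apply: (filterS AU); apply: open_nbhs_nbhs; split => //.
by exists [set A]; rewrite ?bigcup_set1.
Qed.

Lemma beta_hausdorff (T : Type) : hausdorff_space (beta T).
Proof.
move=> p q pq; apply/esym; apply: ultra_eqP => A qA; apply: contrapT => /ultra_setC pA.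
have [||r [rA rnA]] := pq (beta_basic (~` A)) (beta_basic A).
- by apply/beta_nbhsP; exists (~` A).
- by apply/beta_nbhsP; exists A.
- have [x []] := @ultra_nonempty _ r (~` A `&` A) (filterI rA rnA).
  by [].
Qed.

(** An ultrafilter [F] on [beta T] converges to the ultrafilter of those [A]
    whose basic clopen set belongs to [F]. *)
Lemma beta_compact (T : Type) : compact [set: beta T].
Proof.
rewrite compact_ultra => F FF _.
have pF : UltraFilter [set A : set T | F (beta_basic A)].
  apply: ultra_of_dichotomy => [|A].
    split.
      move=> F0; have [q q0] := @filter_ex _ F _ _ F0.
      by have [] := ultra_nonempty q0.
    split=> [|A B FA FB|A B AB].
    - by apply: (@filterE _ F) => q; exact: filterT.
    - by apply: (@filterS2 _ F) FA FB => q; exact: filterI.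
    - by apply: (@filterS _ F) => q; exact: filterS.
  have [FA|FA] := in_ultra_setVsetC (beta_basic A) FF; first by left.
  by right; apply: (@filterS _ F) FA => q; exact: ultra_setC.
exists (Beta pF); split => // U /beta_nbhsP[A pA AU].
exact: filterS AU pA.
Qed.

Lemma bigcap_chain_nonempty (X : topologicalType) (F : set (set X)) :
  compact [set: X] -> F !=set0 -> total_on F subset ->
  (forall A, F A -> closed A /\ A !=set0) -> \bigcap_(A in F) A !=set0.
Proof.
move=> cX F0 Ftot Fcl.
have FF : ProperFilter (filter_from F id).
  apply: filter_from_proper; last by move=> A /Fcl[].
  apply: filter_from_filter => // A B FA FB.
  have [AB|BA] := Ftot _ _ FA FB; [exists A|exists B] => //.
    by move=> x Ax; split => //; exact: AB.
  by move=> x Bx; split => //; exact: BA.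
have [|x [_ Fx]] := cX _ FF; first by have [A FA] := F0; exists A.
exists x => A FA; have [+ _] := Fcl _ FA; apply => B Bx.
by apply: Fx => //; exists A.
Qed.

(** Zorn's lemma applied to the complements, relative to [A], of the sets of
    interest: by compactness a chain of nonempty closed sets has a nonempty
    intersection. *)
Lemma ex_minimal_closed (X : topologicalType) (P : set (set X)) (A : set X) :
  compact [set: X] -> (forall B, P B -> closed B /\ B !=set0) ->
  (forall F, F !=set0 -> F `<=` P -> \bigcap_(B in F) B !=set0 ->
    P (\bigcap_(B in F) B)) ->
  P A -> exists M, [/\ P M, M `<=` A & forall N, P N -> N `<=` M -> N = M].
Proof.
move=> cX Pcl Pcap PA.
have [F FP Ftot|B [PB Bmax]] := @Zorn_bigcup X [set B | P (A `\` B)].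
  rewrite /=; have [->|/set0P F0] := eqVneq F set0.
    by rewrite bigcup_set0 setD0.
  have -> : A `\` \bigcup_(B in F) B = \bigcap_(C in (setD A) @` F) C.
    apply/seteqP; split=> [x [Ax Fx] _ [B FB <-]|x FAx].
      by split => // Bx; apply: Fx; exists B.
    split=> [|[B FB Bx]].
      by have [B FB] := F0; have [] := FAx (A `\` B); first by exists B.
    by have [] := FAx (A `\` B); first by exists B.
  have DP : (setD A) @` F `<=` P by move=> _ [B FB <-]; exact: FP.
  have D0 : (setD A) @` F !=set0 by have [B FB] := F0; exists (A `\` B), B.
  apply: Pcap => //; apply: bigcap_chain_nonempty => //.
    move=> _ _ [B FB <-] [C FC <-].
    by have [BC|CB] := Ftot _ _ FB FC; [right|left]; apply: setDS.
  by move=> C /DP/Pcl.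
exists (A `\` B); split; [exact: PB|exact: subDsetl|].
move=> N PN NAB; apply/seteqP; split => // x ABx; apply: contrapT => Nx.
apply: (Bmax (~` N)); last first.
  rewrite /= setDE setCK (_ : A `&` N = N) //.
  by apply/seteqP; split => [y []//|y Ny]; split => //; have [] := NAB _ Ny.
split; first by move=> y By Ny; have [_ nBy] := NAB _ Ny.
by move=> /(_ x Nx); have [] := ABx.
Qed.

(** * Idempotents and minimal left ideals *)

Local Open Scope group_scope.

Lemma beta_mulE (S : semigroupType) (p q : beta S) (A : set S) :
  ultra_of (p * q) A = ultra_of p [set x | ultra_of q [set y | A (x * y)]].
Proof. by []. Qed.

Lemma principal_mulE (S : semigroupType) (s : S) (q : beta S) (A : set S) :
  ultra_of (principal s * q) A = ultra_of q [set y | A (s * y)].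
Proof. by rewrite beta_mulE; apply/propext; exact: principal_filterP. Qed.

Section beta_semigroup.
Variable S : semigroupType.
Implicit Types (p q x y : beta S) (M L : set (beta S)).

Lemma continuous_beta_mulr q : continuous (fun p : beta S => p * q).
Proof.
move=> p U /beta_nbhsP[A pA AU]; apply/beta_nbhsP.
by exists [set x | ultra_of q [set y | A (x * y)]] => // r rA; exact: AU.
Qed.

(** Such a set is a continuous image of a compact set in a Hausdorff space. *)
Lemma closed_beta_mulr M q : closed M -> closed [set p * q | p in M].
Proof.
move=> Mcl; apply: compact_closed; first exact: beta_hausdorff.
apply: continuous_compact; last exact: subclosed_compact Mcl (@beta_compact _) _.
by apply: continuous_subspaceT; exact: continuous_beta_mulr.
Qed.

Lemma closed_beta_mulr_eq q p : closed [set x | x * q = p].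
Proof.
have -> : [set x | x * q = p] = (fun x => x * q) @^-1` [set p] by [].
apply: preimage_closed; first by move=> x _; exact: continuous_beta_mulr.
by apply: compact_closed; [exact: beta_hausdorff|exact: compact_set1].
Qed.

(** Ellis' lemma.  In a minimal closed subsemigroup [N] with an element [e],
    both [N e] and the set of [x] in [N] with [x e = e] are closed
    subsemigroups, so they are equal to [N]. *)
Lemma idempotent_in_closed M : closed M -> M !=set0 ->
  (forall x y, M x -> M y -> M (x * y)) -> exists2 e, M e & e * e = e.
Proof.
move=> Mcl M0 Mmul.
pose P := [set N : set (beta S) |
  [/\ closed N, N !=set0 & forall x y, N x -> N y -> N (x * y)]].
have [| | |N [[Ncl [e Ne] Nmul] NM Nmin]] := @ex_minimal_closed _ P M (@beta_compact _).
- by move=> N [].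
- move=> F _ FP F0; split => //; first by apply: closed_bigI => N /FP[].
  by move=> x y Fx Fy N FN; have [_ _ +] := FP _ FN; apply; [exact: Fx|exact: Fy].
- by split.
exists e; first exact: NM.
have Nee : [set x * e | x in N] = N.
  apply: Nmin; last by move=> _ [x Nx <-]; exact: Nmul.
  split; first exact: closed_beta_mulr.
    by exists (e * e), e.
  move=> _ _ [x Nx <-] [y Ny <-]; exists (x * e * y); last by rewrite !mulgA.
  exact: (Nmul _ _ (Nmul _ _ Nx Ne) Ny).
have : [set x | N x /\ x * e = e] = N.
  apply: Nmin; last by move=> x [].
  split.
  - by apply: closedI => //; exact: closed_beta_mulr_eq.
  - by have : N e by []; rewrite -{1}Nee => -[x Nx xe]; exists x.
  - move=> x y [Nx xe] [Ny ye]; split; first exact: Nmul.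
    by rewrite -mulgA ye.
by move=> NE; have : N e by []; rewrite -NE => -[].
Qed.

(** If [L0] is a minimal closed left ideal, the products [l q] with [l] in
    [L0] form a two-sided ideal, so [p = l q] lies in the left ideal [L0 q],
    which inherits minimality.  The idempotent [f] comes from Ellis' lemma
    applied to the closed subsemigroup of those [x] in [L] with [x p = p]; it
    is a right identity of [L] because [L] consists of the multiples of [f]. *)
Lemma minimal_ultrafilter_idempotent p : minimal_ultrafilter p ->
  exists2 L : set (beta S),
    [/\ closed L, L p, forall x y, L y -> L (x * y) &
        forall x y, L x -> L y -> exists t, t * x = y] &
    exists f, [/\ L f, f * p = p & forall x, L x -> x * f = x].
Proof.
move=> pK.
pose P := [set N : set (beta S) |
  [/\ closed N, N !=set0 & forall x y, N y -> N (x * y)]].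
have [| | |L0 [[L0cl [l0 L0l0] L0mul] _ L0min]] :=
    @ex_minimal_closed _ P setT (@beta_compact _).
- by move=> N [].
- move=> F _ FP F0; split => //; first by apply: closed_bigI => N /FP[].
  by move=> x y Fy N FN; have [_ _ +] := FP _ FN; apply; exact: Fy.
- by split => //; exists p.
have L0E l : L0 l -> [set x * l | x in setT] = L0.
  move=> L0l; apply: L0min; last by move=> _ [x _ <-]; exact: L0mul.
  split; first by apply: closed_beta_mulr; exact: closedT.
    by exists (l * l), l.
  by move=> x _ [y _ <-]; exists (x * y); rewrite ?mulgA.
have [l L0l [q pE]] : exists2 l, L0 l & exists q, l * q = p.
  apply: (pK [set z | exists2 l, L0 l & exists q, l * q = z]).
  split=> //; split; first by exists (l0 * l0), l0 => //; exists l0.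
  move=> x _ [l L0l [q <-]]; split.
    by exists (x * l); [exact: L0mul|exists q; rewrite mulgA].
  by exists l => //; exists (q * x); rewrite mulgA.
pose L := [set l * q | l in L0].
have Lp : L p by exists l.
have Lmul x y : L y -> L (x * y).
  by move=> [z Lz <-]; exists (x * z); [exact: L0mul|rewrite mulgA].
have Lmin x y : L x -> L y -> exists t, t * x = y.
  move=> [a La <-] [b Lb <-]; move: Lb; rewrite -(L0E _ La) => -[t _ <-].
  by exists t; rewrite mulgA.
have Lcl : closed L by exact: closed_beta_mulr.
have [|||f [Lf fp] ff] := @idempotent_in_closed [set x | L x /\ x * p = p].
- by apply: closedI => //; exact: closed_beta_mulr_eq.
- have [t tp] := Lmin _ _ (Lmul p _ Lp) Lp; exists (t * p); split; first exact: Lmul.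
  by rewrite -mulgA.
- move=> x y [Lx xp] [Ly yp]; split; first exact: Lmul.
  by rewrite -mulgA yp.
exists L => //; exists f; split => // x /(Lmin _ _ Lf)[t <-].
by rewrite -mulgA ff.
Qed.

End beta_semigroup.

(** * Fixed points of ultrafilters *)

Section fixpoints.
Variables (T : choiceType) (g : T -> T) (t0 : T).
Local Open Scope nat_scope.

(** The connected component of [y] in the functional graph of [g]. *)
Definition component (y : T) : set T :=
  [set z | exists m n, iter m g y = iter n g z].

Lemma component_step (y : T) : component (g y) = component y.
Proof.
apply/seteqP; split => z [m [n]].
  by rewrite -iterSr => e; exists m.+1, n.
by move=> e; exists m, n.+1; rewrite -iterSr /= e.
Qed.

Lemma component_refl (y : T) : component y y. Proof. by exists 0, 0. Qed.

Definition periodic : set T := [set z | exists n, iter n.+1 g z = z].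

(** A point chosen in the component of [y] by means of the component alone; it
    lies on the cycle of the component when there is one. *)
Definition component_rep (y : T) : T :=
  let C := component y in
  if `[< C `&` periodic !=set0 >] then xget t0 (C `&` periodic) else xget t0 C.

Lemma component_rep_step (y : T) : component_rep (g y) = component_rep y.
Proof. by rewrite /component_rep component_step. Qed.

Lemma component_rep_in (y : T) : component y (component_rep y).
Proof.
rewrite /component_rep; case: asboolP => [yper|_].
  by have [] := xgetPex t0 yper.
by apply: (xgetPex t0); exists y; exact: component_refl.
Qed.

Lemma component_rep_periodic (y z : T) :
  component y z -> periodic z -> periodic (component_rep y).
Proof.
move=> yz zper; rewrite /component_rep; case: asboolP => [yper|[]]; last by exists z.
by have [] := xgetPex t0 yper.
Qed.

Definition first_hit (y : T) (m : nat) : Prop :=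
  iter m g y = component_rep y /\ forall k, k < m -> iter k g y <> component_rep y.

Lemma first_hit_uniq (y : T) (m m' : nat) : first_hit y m -> first_hit y m' -> m = m'.
Proof.
by move=> [ym my] [ym' my']; case: (ltngtP m m') => // [/my'|/my].
Qed.

Lemma first_hit_ex (y : T) (m : nat) : iter m g y = component_rep y -> exists k, first_hit y k.
Proof.
move=> ym; have : exists k, `[< iter k g y = component_rep y >] by exists m; exact/asboolP.
move=> /ex_minnP[k /asboolP yk kmin]; exists k; split => // j jk yj.
by have := kmin j (asboolT yj); rewrite leqNgt jk.
Qed.

Lemma first_hit_step (y : T) (m : nat) : first_hit y m -> y <> component_rep y ->
  exists2 m', m = m'.+1 & first_hit (g y) m'.
Proof.
case: m => [[//]|m] [ym my] _; exists m => //; rewrite /first_hit component_rep_step.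
by rewrite -iterSr; split => // k km; rewrite -iterSr; exact: my.
Qed.

Lemma periodic_rep_reached (y : T) : periodic (component_rep y) ->
  exists m, iter m g y = component_rep y.
Proof.
move=> [P iP]; have [m [n yn]] := component_rep_in y.
have iPn k : iter (k * P.+1) g (component_rep y) = component_rep y.
  by elim: k => // k IH; rewrite mulSn iterD IH.
by exists (n * P + m); rewrite iterD yn -iterD -mulnSr iPn.
Qed.

Lemma iter_rep_inj (y : T) : ~ periodic (component_rep y) ->
  injective (fun n => iter n g (component_rep y)).
Proof.
move=> nper m n.
wlog mn : m n / m < n.
  by move=> H; case: (ltngtP m n) => // [/H|/H H' /esym/H'].
move=> e; case: nper; apply: (@component_rep_periodic _ (iter m g (component_rep y))).
  have [a [b yab]] := component_rep_in y; exists (m + a), b.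
  by rewrite iterD yab -!iterD addnC.
exists (n - m).-1; rewrite prednK ?subn_gt0// -iterD subnK; last exact: ltnW.
by rewrite e.
Qed.

Lemma component_parity_uniq (y : T) (m n m' n' : nat) : ~ periodic (component_rep y) ->
  iter m g y = iter n g (component_rep y) -> iter m' g y = iter n' g (component_rep y) ->
  odd (m + n) = odd (m' + n').
Proof.
move=> nper; wlog mm' : m n m' n' / m <= m'.
  by move=> H e e'; case: (leqP m m') => [/H|/ltnW/H H']; [exact|exact/esym/H'].
move=> e; rewrite -{1}(subnK mm') iterD e -iterD => /(iter_rep_inj nper) <-.
by rewrite !oddD oddB//; case: (odd m); case: (odd m'); case: (odd n).
Qed.

(** Katetov's theorem.  If [g] maps [p] to itself, every boolean colouring of
    the points agrees with its composition with [g] on a member of [p].  Three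
    colourings distinguish [y] from [g y] unless [y] is fixed: being the
    representative of the component, the parity of the time at which the orbit
    of [y] first reaches the representative, and, when it never does, the parity
    of m + n for any m and n with g^m y = g^n (component_rep y). *)
Lemma ultra_fixpoints (p : beta T) :
  (forall A, ultra_of p A -> ultra_of p (g @^-1` A)) ->
  ultra_of p [set y | g y = y].
Proof.
move=> gp.
have agree (c : T -> bool) : ultra_of p [set y | c (g y) = c y].
  have [/[dup] /gp|/ultra_setC/[dup]/gp] := pselect (ultra_of p [set y | c y]).
    by apply: filterS2 => y /= -> ->.
  by apply: filterS2 => y /= /negP/negPf -> /negP/negPf ->.
pose c1 y := `[< y = component_rep y >].
pose c2 y := `[< exists2 m, first_hit y m & odd m >].
pose c3 y := `[< exists m n, iter m g y = iter n g (component_rep y) /\ odd (m + n) >].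
apply: filterS3 (agree c1) (agree c2) (agree c3) => y /=.
have [yr|yr] := pselect (y = component_rep y).
  rewrite /c1 component_rep_step -yr (asboolT (erefl y)) => /asboolP gy _ _.
  by rewrite gy.
move=> _ e2 e3; exfalso.
have [[m /first_hit_ex[k yk]]|nreach] := pselect (exists m, iter m g y = component_rep y).
  have [k' kk' gyk'] := first_hit_step yk yr.
  have c2y : c2 y = odd k.
    by apply/asboolP/idP => [[j /(first_hit_uniq yk) <-]//|]; exists k.
  have c2gy : c2 (g y) = odd k'.
    by apply/asboolP/idP => [[j /(first_hit_uniq gyk') <-]//|]; exists k'.
  by move: e2; rewrite c2y c2gy kk' /=; case: odd.
have nper : ~ periodic (component_rep y) by move=> /periodic_rep_reached.
have [m [n ymn]] := component_rep_in y.
have gymn : iter m g (g y) = iter n.+1 g (component_rep y).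
  by rewrite -iterSr /= ymn.
have c3y : c3 y = odd (m + n).
  apply/asboolP/idP => [[m' [n' [e]]]|]; last by exists m, n.
  by rewrite (component_parity_uniq nper ymn e).
have c3gy : c3 (g y) = odd (m + n.+1).
  rewrite /c3 component_rep_step; apply/asboolP/idP => [[m' [n' [e]]]|]; last by exists m, n.+1.
  have := @component_parity_uniq (g y) m n.+1 m' n'; rewrite component_rep_step.
  by move=> /(_ nper gymn e) ->.
by move: e3; rewrite c3y c3gy addnS /=; case: odd.
Qed.

End fixpoints.

(** If [k + 1] points fixed [p], their sets of fixed points would belong to
    [p] by Katetov's theorem, and a common element [y] would have all of them
    in [Fix y]. *)
Lemma finite_fixers (S : semigroupType) (k : nat) (p : beta S) :
  (forall a : S, Fix a #<= `I_k) ->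
  finite_set [set s | principal s * p = p].
Proof.
move=> fixk; apply: contrapT => /(@infinite_set_fset S _ k.+1)[E EF kE].
have [y0 _] := @ultra_nonempty _ p setT filterT.
have [y Ey] : (\bigcap_(s in [set` E]) [set y | s * y = y]) !=set0.
  apply: (@ultra_nonempty _ p); apply: filter_bigI => s sE.
  have /= sp := EF _ sE.
  apply: (ultra_fixpoints y0) => A; by rewrite -{1}sp principal_mulE.
have /card_le_trans/(_ (fixk y)) : [set` E] #<= Fix y by exact: subset_card_le.
have /card_eqPle[_ /card_le_trans/[apply]] : [set` E] #= `I_(size E) by exact/card_eq_fsetP.
by rewrite card_le_II leqNgt kE.
Qed.

(** * Uniform ultrafilters *)

Definition uniform (T : Type) (q : beta T) : Prop :=
  forall A, ultra_of q A -> [set: T] #<= A.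

Lemma uniform_remainder (T : Type) (q : beta T) :
  infinite_set [set: T] -> uniform q -> remainder T q.
Proof.
move=> Tinf uq [x _ xq]; apply: (@finite_not_card_ge _ setT Tinf _ [set x]).
  exact: finite_set1.
by apply: uq; rewrite -xq /=; apply/principal_filterP.
Qed.

Lemma ex_uniform (T : choiceType) :
  infinite_set [set: T] -> exists q : beta T, uniform q.
Proof.
move=> Tinf; pose F := [set A : set T | ~ ([set: T] #<= ~` A)].
have FF : ProperFilter F.
  split; first by rewrite /F /= setC0; apply; exact: card_lexx.
  split.
  - by rewrite /F /= setCT; exact: finite_not_card_ge.
  - by move=> A B FA FB; rewrite /F /= setCI; exact: not_card_geU.
  - move=> A B AB FA TB; apply: FA; apply: card_le_trans TB _.
    by apply: subset_card_le; exact: subsetC.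
have [G [GU FG]] := ultraFilterLemma FF.
exists (Beta GU) => A GA; apply: contrapT => nA.
have /FG GnA : F (~` A) by rewrite /F /= setCK.
by have [x []] := @filter_ex _ G _ _ (filterI GA GnA).
Qed.

Section very_weakly_cancellative.
Variable S : semigroupType.
Hypothesis infS : infinite_set [set: S].
Hypothesis vwcS : very_weakly_cancellative S.
Implicit Types (p q u : beta S) (A D : set S).

Lemma bigcup_solution_set (J : Type) (E : set J) (X : J -> set S) :
  (forall j, E j -> solution_set (X j)) -> ~ ([set: S] #<= E) ->
  ~ ([set: S] #<= \bigcup_(j in E) X j).
Proof.
move=> Xsol nE; have nXE : ~ ([set: S] #<= X @` E).
  by move=> SX; apply: nE; apply: card_le_trans SX (card_image_le _ _).
have [||_] := vwcS (F := X @` E); last by rewrite bigcup_image.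
- by move=> _ [j Ej <-]; exact: Xsol.
- by split=> //; have [] := card_le_total (X @` E) [set: S].
Qed.

(** If [A] is a member of [p q], some translation y -> x y maps a member of [q]
    into [A].  If [A] had fewer than |S| elements, that member would be covered
    by fewer than |S| left solution sets. *)
Lemma uniform_mull p q : uniform q -> uniform (p * q).
Proof.
move=> uq A; rewrite beta_mulE => /ultra_nonempty[x qx]; have SxA := uq _ qx.
apply: contrapT => nA.
apply: (@bigcup_solution_set _ A (left_solution_set x) _ nA).
  by move=> b _; exists x, b; left.
apply: card_le_trans SxA _; apply: subset_card_le => y /= Axy.
by exists (x * y).
Qed.

(** If [q] is not uniform, it has a member [D] with fewer than |S| elements.  If
    [u q] has such a member [A] too, then the sets of solutions x of x y = b,
    with [y] in [D] and [b] in [A], cover a member of [u], and there are fewer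
    than |S| of them. *)
Lemma uniform_mulr u q : uniform u -> uniform (u * q).
Proof.
move=> uu; have [uq|/existsNP[D /not_implyP[qD nD]]] := pselect (uniform q).
  exact: uniform_mull.
move=> A uqA; apply: contrapT => nA.
apply: (@bigcup_solution_set _ (D `*` A) (fun z => right_solution_set z.1 z.2)).
- by move=> [y b] _; exists y, b; right.
- exact: not_card_geX.
- apply: card_le_trans (uu _ uqA) _; apply: subset_card_le => x /= qx.
  have [y [Axy Dy]] := ultra_nonempty (filterI qx qD).
  by exists (y, x * y).
Qed.

Lemma minimal_ultrafilter_uniform p : minimal_ultrafilter p -> uniform p.
Proof.
move=> pK; apply: (pK [set q | uniform q]); split=> //.
split; first exact: ex_uniform.
by move=> x y uy; split; [exact: uniform_mull|exact: uniform_mulr].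
Qed.

End very_weakly_cancellative.

(** * Sparse ultrafilters *)

Lemma filter_seq (T : Type) (I : eqType) (F : set_system T) (A : I -> set T)
    (s : seq I) : Filter F -> (forall x, x \in s -> F (A x)) ->
  F [set y | forall x, x \in s -> A x y].
Proof.
move=> FF; elim: s => [|x s IH] FA; first by apply: filterE.
have Fs : F [set y | forall z, z \in s -> A z y].
  by apply: IH => z zs; apply: FA; rewrite inE zs orbT.
apply: filterS2 (FA x (mem_head _ _)) Fs => y Ax As z.
by rewrite inE => /orP[/eqP ->//|/As].
Qed.

Section sparse.
Variable S : semigroupType.
Hypothesis infS : infinite_set [set: S].
Hypothesis vwcS : very_weakly_cancellative S.

(** Recursion along an initial order of the index set: at each index the
    equations with the earlier points give fewer than |S| solution sets, which
    do not cover the member of [f] from which the next point is taken. *)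
Lemma ex_sparse_family (f : beta S) (A : S -> set S) : uniform f ->
  (forall x, ultra_of f (A x)) -> exists r : seq S * bool -> S,
    (forall i x, x \in i.1 -> A x (r i)) /\
    (forall i j x x', i <> j -> x \in i.1 -> x' \in j.1 -> x * r i <> x' * r j).
Proof.
move=> uf fA.
have [s1 _] := infinite_setN0 infS.
have [s2 [_ s12]] : ([set: S] `\ s1) !=set0.
  by apply: infinite_setN0; apply: infinite_setD => //; exact: finite_set1.
have IS : [set: seq S * bool] #<= [set: S].
  apply: (card_le_trans _ (card_seq infS)); apply/(card_le_injP nil).
  exists (fun i => (if i.2 then s1 else s2) :: i.1); split => //.
  by move=> [H [|]] [H' [|]] _ _ //= [] => [|/esym /s12|/s12|] // ->.
have [R [Rwf Rtot Rsmall]] := ex_initial_order (seq S * bool).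
pose C (i : seq S * bool) y := forall x, x \in i.1 -> A x y.
pose Q (i j : seq S * bool) y y' :=
  forall x x', x \in i.1 -> x' \in j.1 -> x * y <> x' * y'.
have [r rP] : exists r, forall i, C i (r i) /\ forall j, R j i -> Q i j (r i) (r j).
  apply: (wf_choice s1) => // i g.
  have Ci : ultra_of f (C i) by apply: filter_seq.
  pose V := \bigcup_(j in [set j | R j i]) [set` [seq x' * g j | x' <- j.1]].
  have nV : ~ ([set: S] #<= V).
    by apply: not_card_ge_bigcup => // Sj; apply: (Rsmall i); exact: card_le_trans Sj.
  have nW : ~ ([set: S] #<= \bigcup_(z in [set` i.1] `*` V) left_solution_set z.1 z.2).
    apply: bigcup_solution_set => //; first by move=> [x b] _; exists x, b; left.
    by apply: not_card_geX => //; apply: finite_not_card_ge => //; exact: finite_seq.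
  apply: contrapT => nex; apply: nW; apply: card_le_trans (uf _ Ci) _.
  apply: subset_card_le => y Cy; apply: contrapT => nW; apply: nex.
  exists y; split => // j Rji x x' xi xj xx'; apply: nW.
  exists (x, x' * g j) => //; split => //=.
  by exists j => //=; apply/mapP; exists x'.
exists r; split; first by move=> i; have [] := rP i.
move=> i j x x' ij xi xj; have [Rij|Rji] := Rtot _ _ ij.
  by have [_ /(_ _ Rij) H] := rP j; apply: nesym; exact: H.
by have [_ /(_ _ Rji) H] := rP i; exact: H.
Qed.

(** The boolean index provides two disjoint candidates for [B], of which at
    least one is not a member of [p].  The ultrafilter [r] is a limit of the
    points r_(H,b) along the lists [H]. *)
Lemma ex_sparse_ultrafilter (p f : beta S) (A : S -> set S) : uniform f ->
  (forall x, ultra_of f (A x)) -> exists (r : beta S) (B : set S),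
    [/\ ~ ultra_of p B, forall x, ultra_of r (A x),
        forall x, ultra_of (principal x * r) B &
        forall x, remainder S (principal x * r)].
Proof.
move=> uf fA; have [r [rA rinj]] := ex_sparse_family uf fA.
pose B b := [set z | exists H x, x \in H /\ z = x * r (H, b)].
have [b pB] : exists b, ~ ultra_of p (B b).
  have [pB|npB] := pselect (ultra_of p (B true)); last by exists true.
  exists false => pB'; have [z []] := ultra_nonempty (filterI pB pB').
  move=> [H [x [xH ->]]] [H' [x' [xH']]].
  by apply: (rinj (H, true) (H', false)).
(* Asking for length as well as for inclusion makes every single list drop out
   eventually, so that no [x * r] is principal. *)
pose cone (K : seq S) := [set H : seq S | {subset K <= H} /\ size K <= size H].
have FF : ProperFilter (filter_from setT (fun K => (fun H => r (H, b)) @` cone K)).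
  apply: filter_from_proper; last by move=> K _; exists (r (K, b)), K => //; split.
  apply: filter_from_filter; first by exists nil.
  move=> K K' _ _; exists (K ++ K') => // _ [H [KH sH] <-]; rewrite size_cat in sH.
  split; exists H => //; split.
  - by move=> x xK; apply: KH; rewrite mem_cat xK.
  - by apply: leq_trans sH; exact: leq_addr.
  - by move=> x xK; apply: KH; rewrite mem_cat xK orbT.
  - by apply: leq_trans sH; exact: leq_addl.
have [G [GU FG]] := ultraFilterLemma FF.
have Gcone K : G ((fun H => r (H, b)) @` cone K) by apply: FG; exists K.
exists (Beta GU), (B b); split => //.
- move=> x; apply: filterS (Gcone [:: x]) => _ [H [xH _] <-].
  by apply: rA; apply: xH; rewrite mem_head.
- move=> x; rewrite principal_mulE; apply: filterS (Gcone [:: x]) => _ [H [xH _] <-] /=.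
  by exists H, x; split => //; apply: xH; rewrite mem_head.
- move=> x [c _ cE].
  have Gc : G [set y | x * y = c].
    have : ultra_of (principal c) [set c] by apply/principal_filterP.
    by rewrite cE principal_mulE.
  have [_ [[H [xH _] <-]] /= Hc] := @filter_ex _ G _ _ (filterI (Gcone [:: x]) Gc).
  have [_ [[H' [xH' sH'] <-]] /= Hc'] := @filter_ex _ G _ _ (filterI (Gcone (x :: H)) Gc).
  apply: (rinj (H, b) (H', b) x x); rewrite ?Hc ?Hc' //.
  + by move=> [HH']; move: sH'; rewrite HH' /= ltnn.
  + by apply: xH; rewrite mem_head.
  + by apply: xH'; rewrite mem_head.
Qed.

End sparse.

(** * Non-normality *)

(** If the conclusion fails for the given [q], then the points [x] with
    [x f = p] form a member of [q], and [f q] is a second candidate because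
    [f p = p].  If both fail, then for f-many [s] some [x] satisfies
    [x f = p = s x f], whence [s p = p]; but a member of [f] is infinite. *)
Lemma ex_left_factor (S : semigroupType) (k : nat) (f g p : beta S) :
  infinite_set [set: S] -> (forall a : S, Fix a #<= `I_k) -> uniform f ->
  f * p = p -> (exists q, q * g = p) ->
  exists2 q, q * g = p & ultra_of q [set x | principal x * f <> p].
Proof.
move=> infS fixk uf fp [q qE].
have [qX0|/ultra_setC qX0] := pselect (ultra_of q [set x | principal x * f = p]);
  last by exists q.
exists (f * q); first by rewrite -mulgA qE.
apply: contrapT => /ultra_setC; rewrite beta_mulE => fX0.
have Sfix : [set: S] #<= [set s | principal s * p = p].
  apply: uf; apply: (@filterS _ (ultra_of f)) fX0 => s /= sX0.
  have [x [sx xp]] := ultra_nonempty (filterI sX0 qX0).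
  by move: sx => /= /contrapT; rewrite principalM -mulgA xp.
exact: finite_not_card_ge infS _ _ (finite_fixers _ fixk) Sfix.
Qed.

Lemma subtype_nbhsP (T : Type) (X : set (beta T)) (w : set_type X) (U : set (set_type X)) :
  nbhs w U <->
  exists2 A, ultra_of (set_val w) A & forall w' : set_type X, ultra_of (set_val w') A -> U w'.
Proof.
split.
  rewrite nbhsE => -[V [[W Wo WV] Vw] VU].
  have /beta_nbhsP[A wA AW] : nbhs (set_val w) W.
    by apply: open_nbhs_nbhs; split => //; move: Vw; rewrite -WV.
  by exists A => // w' /AW Ww'; apply: VU; rewrite -WV.
move=> [A wA AU]; have : nbhs (set_val w) (beta_basic A) by apply/beta_nbhsP; exists A.
move=> /(@initial_continuous (set_type X) (beta T) set_val w) wA'.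
by apply: (@filterS _ (nbhs w)) wA' => w'; exact: AU.
Qed.

Theorem theorem3p11 (S : semigroupType)
  (infS : infinite_set [set: S])
  (vwcS : very_weakly_cancellative S)
  (fixS : exists k : nat, forall a : S, Fix a #<= `I_k)
  (p : beta S) (minp : minimal_ultrafilter p) :
  ~ normal_space (set_type (remainder S `\ p)).
Proof.
have [k fixk] := fixS.
have up : uniform p by exact: minimal_ultrafilter_uniform.
have [L [Lcl Lp Lmul Lmin] [f [Lf fp Lf1]]] := minimal_ultrafilter_idempotent minp.
have uf : uniform f by have [t <-] := Lmin _ _ Lp Lf; exact: uniform_mull.
set X := remainder S `\ p => normX.
have val_cont : continuous (set_val : set_type X -> beta S).
  exact: initial_continuous.
pose F : set (set_type X) := set_val @^-1` L.
pose G : set (set_type X) := set_val @^-1` [set z | z * f = p].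
have Fcl : closed F by apply: preimage_closed Lcl => w _; exact: val_cont.
have Gcl : closed G.
  by apply: preimage_closed (@closed_beta_mulr_eq S f p) => w _; exact: val_cont.
have FG : F `<=` ~` G.
  by move=> w Fw; rewrite /G /= (Lf1 _ Fw) => wp; have [_] := set_valP w; apply.
have [U FU UG] : filter_from (set_nbhs F) closure (~` G).
  apply: normX => //; apply/set_nbhsP; exists (~` G); split => //.
  exact: closed_openC.
have toX z : remainder S z -> z <> p -> exists w : set_type X, set_val w = z.
  by move=> rz zp; exists (SigSub (mem_set (conj rz zp : X z))).
(* When x f = p the choice is immaterial, but [f] has to contain all translates. *)
have /choice[D DP] : forall x : S, exists A, ultra_of (principal x * f) A /\
    (principal x * f <> p ->
      forall w : set_type X, ultra_of (set_val w) A -> U w).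
  move=> x; have [xp|xp] := pselect (principal x * f = p).
    by exists setT; split; [exact: filterT|].
  have [|w wE] := toX (principal x * f) _ xp.
    by apply: uniform_remainder => //; exact: uniform_mull.
  have /FU/subtype_nbhsP[A wA AU] : F w by rewrite /F /= wE; exact: Lmul.
  by exists A; rewrite -wE.
have fA x : ultra_of f [set y | D x (x * y)].
  by rewrite -principal_mulE; have [] := DP x.
have [r [B [pB rA rB rS]]] := ex_sparse_ultrafilter infS vwcS p uf fA.
have [q qrf qX0] : exists2 q, q * (r * f) = p &
    ultra_of q [set x | principal x * f <> p].
  exact: (ex_left_factor infS fixk uf fp (Lmin _ _ (Lmul r _ Lf) Lp)).
have qrB : ultra_of (q * r) B.
  rewrite beta_mulE; apply: (@filterE _ (ultra_of q)) => x /=.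
  by have := rB x; rewrite principal_mulE.
have [||w wE] := toX (q * r).
- move=> [c _ cE].
  have : ultra_of (q * r) [set c] by rewrite -cE; apply/principal_filterP.
  rewrite beta_mulE => /ultra_nonempty[x /= rxc]; apply: (rS x); exists c => //.
  apply: ultra_eqP => A /principal_filterP Ac; rewrite principal_mulE.
  by apply: filterS rxc => y /= ->.
- by move=> qrp; apply: pB; rewrite -qrp.
have Gw : G w by rewrite /G /= wE -mulgA.
(* [w], whose value is q r, lies in the closure of [U]: each neighbourhood [V]
   of it contains some x r with x f <> p, and x r lies in [U]. *)
apply: (UG w) => // V /subtype_nbhsP[E wE' EV].
move: wE'; rewrite wE beta_mulE => qE.
have [x [/= xp xE]] := ultra_nonempty (filterI qX0 qE).
have [|w' w'E] := toX (principal x * r) (rS x).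
  by move=> xrp; apply: pB; rewrite -xrp.
exists w'; split; last by apply: EV; rewrite w'E principal_mulE.
have [_ /(_ xp)] := DP x; apply; rewrite w'E principal_mulE; exact: rA.
Qed.
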